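(* Let $(X,\{\alpha_i\},Y,\{h_i\})$ be a root datum of finite type and let $\pi\subset X^+$ be a finite saturated set. Then the defining ideal $\Lambda$ of the generalized Schur algebra $S(\pi)=\mathfrak{U}/\Lambda$ is the two-sided ideal of $\mathfrak{U}$ generated by all elements $\prod_{\lambda\in W\pi}(h-\langle h,\lambda\rangle)$ for $h\in Y$.
   Context: **Root datum.** A Cartan datum is a finite set $I$ with a symmetric $\mathbb{Z}$-valued bilinear form $(\ ,\ )$ on $\mathbb{Z}[I]$ such that $(i,i)\in\{2,4,6,\dots\}$ for $i\in I$ and $2(i,j)/(i,i)\in\{0,-1,-2,\dots\}$ for $i\ne j$. It is of finite type if the matrix $((i,j))_{i,j\in I}$ is positive definite. A root datum associated to it consists of finitely generated free abelian groups $X,Y$, a perfect pairing $\langle\ ,\ \rangle:Y\times X\to\mathbb{Z}$, and embeddings $I\to Y$, $i\mapsto h_i$, and $I\to X$, $i\mapsto\alpha_i$, with $\langle h_i,\alpha_j\rangle=2(i,j)/(i,i)$. The root datum is of finite type if its Cartan datum is. The Weyl group $W$ is generated by $s_i$ ($i\in I$) and acts on $X$ by $s_i(\lambda)=\lambda-\langle h_i,\lambda\rangle\alpha_i$. Write $\lambda\le\lambda'$ if $\lambda'-\lambda\in\sum_i\mathbb{N}\alpha_i$, and $X^+=\{\lambda\in X\mid\langle h_i,\lambda\rangle\in\mathbb{N}\text{ for all }i\}$. A subset $\pi\subset X^+$ is saturated if $\lambda\in\pi$, $\lambda'\in X^+$, $\lambda'\le\lambda$ imply $\lambda'\in\pi$.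 $W\pi\subset X$ is the union of the $W$-orbits of elements of $\pi$. **Enveloping algebra.** Put $\mathfrak{h}=\mathbb{Q}\otimes_{\mathbb{Z}}Y$ (so $Y\subset\mathfrak{h}$) and extend the pairing $\mathbb{Q}$-linearly to $\mathfrak{h}\times X\to\mathbb{Q}$. $\mathfrak{g}$ is the Lie algebra over $\mathbb{Q}$ generated by $\mathfrak{h}$ and $e_i,f_i$ ($i\in I$) with relations $[h,h']=0$, $[h,e_i]=\langle h,\alpha_i\rangle e_i$, $[h,f_i]=-\langle h,\alpha_i\rangle f_i$, $[e_i,f_j]=\delta_{ij}h_i$, and $(\mathrm{ad}\,e_i)^{1-\langle h_i,\alpha_j\rangle}e_j=0=(\mathrm{ad}\,f_i)^{1-\langle h_i,\alpha_j\rangle}f_j$ for $i\neq j$ ($h,h'\in\mathfrak{h}$, $i,j\in I$). $\mathfrak{U}=\mathfrak{U}(\mathfrak{g})$ is its universal enveloping algebra. **Generalized Schur algebra.** For a $\mathfrak{U}$-module $V$ and $\lambda\in X$, $V_\lambda=\{m\in V\mid hm=\langle h,\lambda\rangle m\ \forall h\in\mathfrak{h}\}$. $\mathcal{C}$ is the category of $\mathfrak{U}$-modules $V$ with $V=\bigoplus_{\lambda\in X}V_\lambda$, and $\mathcal{C}[\pi]$ is its full subcategory of those $M$ with $M=\bigoplus_{\lambda\in W\pi}M_\lambda$. The defining ideal $\Lambda$ is the ideal of all elements of $\mathfrak{U}$ annihilating every object of $\mathcal{C}[\pi]$, and $S(\pi)=\mathfrak{U}/\Lambda$. *)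

(* Defs.v *)
From HB Require Import structures.
From mathcomp Require Import all_boot all_order all_algebra finmap.
From mathcomp Require Import boolp classical_sets functions cardinality.

Set Implicit Arguments.
Unset Strict Implicit.
Unset Printing Implicit Defensive.

Import Order.TTheory GRing.Theory Num.Theory.

Local Open Scope classical_set_scope.
Local Open Scope ring_scope.

(** [presented ax] is the Q-vector space with bilinear operations [pop o],
    [o : O], generated by [G] subject to the relations [ax]: the quotient of
    the type of formal expressions by the least congruence that contains [ax]
    and the laws of a vector space with bilinear operations.  It serves three
    times: with no operation for [Q (x) Y], and with one operation for the Lie
    algebra and for its enveloping algebra. *)

Inductive term (O G : Type) : Type :=
| tgen of G
| tzero
| tadd of term O G & term O G
| topp of term O G
| tscale of rat & term O G
| tbin of O & term O G & term O G.

Arguments tgen {O G}.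
Arguments tzero {O G}.
Arguments tadd {O G}.
Arguments topp {O G}.
Arguments tscale {O G}.
Arguments tbin {O G}.

HB.instance Definition _ (O G : Type) := gen_eqMixin (term O G).
HB.instance Definition _ (O G : Type) := gen_choiceMixin (term O G).

Inductive congr_closure (O G : Type) (ax : term O G -> term O G -> Prop) :
    term O G -> term O G -> Prop :=
| cc_ax s t : ax s t -> congr_closure ax s t
| cc_refl s : congr_closure ax s s
| cc_sym s t : congr_closure ax s t -> congr_closure ax t s
| cc_trans t s u :
    congr_closure ax s t -> congr_closure ax t u -> congr_closure ax s u
| cc_add s s' t t' : congr_closure ax s s' -> congr_closure ax t t' ->
    congr_closure ax (tadd s t) (tadd s' t')
| cc_opp s s' : congr_closure ax s s' -> congr_closure ax (topp s) (topp s')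
| cc_scale a s s' : congr_closure ax s s' ->
    congr_closure ax (tscale a s) (tscale a s')
| cc_op o s s' t t' : congr_closure ax s s' -> congr_closure ax t t' ->
    congr_closure ax (tbin o s t) (tbin o s' t')
| cc_addA s t u :
    congr_closure ax (tadd s (tadd t u)) (tadd (tadd s t) u)
| cc_addC s t : congr_closure ax (tadd s t) (tadd t s)
| cc_add0 s : congr_closure ax (tadd tzero s) s
| cc_addN s : congr_closure ax (tadd (topp s) s) tzero
| cc_scaleA a b s :
    congr_closure ax (tscale a (tscale b s)) (tscale (a * b) s)
| cc_scale1 s : congr_closure ax (tscale 1 s) s
| cc_scaleDr a s t : congr_closure ax
    (tscale a (tadd s t)) (tadd (tscale a s) (tscale a t))
| cc_scaleDl a b s : congr_closure ax
    (tscale (a + b) s) (tadd (tscale a s) (tscale b s))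
| cc_opPl o a s s' t : congr_closure ax
    (tbin o (tadd (tscale a s) s') t)
    (tadd (tscale a (tbin o s t)) (tbin o s' t))
| cc_opPr o a s t t' : congr_closure ax
    (tbin o s (tadd (tscale a t) t'))
    (tadd (tscale a (tbin o s t)) (tbin o s t')).

Section Presented.
Variables (O G : Type) (ax : term O G -> term O G -> Prop).

Definition congr_rel (s t : term O G) : bool := `[< congr_closure ax s t >].

Lemma congr_rel_refl : reflexive congr_rel.
Proof. by move=> s; apply/asboolP; exact: cc_refl. Qed.

Lemma congr_rel_sym : symmetric congr_rel.
Proof. by move=> s t; apply/asboolP/asboolP => /cc_sym. Qed.

Lemma congr_rel_trans : transitive congr_rel.
Proof.
by move=> t s u /asboolP st /asboolP tu; apply/asboolP; exact: cc_trans st tu.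
Qed.

Canonical congr_equiv :=
  EquivRel congr_rel congr_rel_refl congr_rel_sym congr_rel_trans.

Definition presented : Type := {eq_quot congr_equiv}%qT.
HB.instance Definition _ := Choice.on presented.

Definition pcls (s : term O G) : presented := \pi_({eq_quot congr_equiv})%qT s.
Definition prep (x : presented) : term O G :=
  @repr _ {eq_quot congr_equiv}%qT x.

Lemma prepK x : pcls (prep x) = x.
Proof. exact: reprK. Qed.

Lemma pclsP s t : pcls s = pcls t <-> congr_closure ax s t.
Proof.
by split=> [/eqmodP/asboolP//|st]; apply/eqmodP; exact/asboolP.
Qed.

Lemma prep_pcls s : congr_closure ax (prep (pcls s)) s.
Proof. by apply/pclsP; rewrite prepK. Qed.

Lemma pclsW (P : presented -> Prop) : (forall s, P (pcls s)) -> forall x, P x.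
Proof. by move=> Pcls x; rewrite -(prepK x). Qed.

Definition pgen (g : G) : presented := pcls (tgen g).
Definition pzero : presented := pcls tzero.
Definition padd (x y : presented) : presented := pcls (tadd (prep x) (prep y)).
Definition popp (x : presented) : presented := pcls (topp (prep x)).
Definition pscale (a : rat) (x : presented) : presented :=
  pcls (tscale a (prep x)).
Definition pop (o : O) (x y : presented) : presented :=
  pcls (tbin o (prep x) (prep y)).

Lemma pcls_add s t : padd (pcls s) (pcls t) = pcls (tadd s t).
Proof. by apply/pclsP/cc_add; exact: prep_pcls. Qed.

Lemma pcls_opp s : popp (pcls s) = pcls (topp s).
Proof. by apply/pclsP/cc_opp; exact: prep_pcls. Qed.

Lemma pcls_scale a s : pscale a (pcls s) = pcls (tscale a s).
Proof. by apply/pclsP/cc_scale; exact: prep_pcls. Qed.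

Lemma pcls_op o s t : pop o (pcls s) (pcls t) = pcls (tbin o s t).
Proof. by apply/pclsP/cc_op; exact: prep_pcls. Qed.

Lemma paddA : associative padd.
Proof.
elim/pclsW=> s; elim/pclsW=> t; elim/pclsW=> u.
by rewrite !pcls_add; apply/pclsP; exact: cc_addA.
Qed.

Lemma paddC : commutative padd.
Proof.
elim/pclsW=> s; elim/pclsW=> t.
by rewrite !pcls_add; apply/pclsP; exact: cc_addC.
Qed.

Lemma padd0 : left_id pzero padd.
Proof. by elim/pclsW=> s; rewrite pcls_add; apply/pclsP; exact: cc_add0. Qed.

Lemma paddN : left_inverse pzero popp padd.
Proof.
by elim/pclsW=> s; rewrite pcls_opp pcls_add; apply/pclsP; exact: cc_addN.
Qed.

HB.instance Definition _ :=
  GRing.isZmodule.Build presented paddA paddC padd0 paddN.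

Lemma pscaleA a b x : pscale a (pscale b x) = pscale (a * b) x.
Proof.
by elim/pclsW: x => s; rewrite !pcls_scale; apply/pclsP; exact: cc_scaleA.
Qed.

Lemma pscale1 : left_id 1 pscale.
Proof.
by elim/pclsW=> s; rewrite pcls_scale; apply/pclsP; exact: cc_scale1.
Qed.

Lemma pscaleDr : right_distributive pscale +%R.
Proof.
move=> a; elim/pclsW=> s; elim/pclsW=> t.
rewrite /GRing.add /= !(pcls_scale, pcls_add).
by apply/pclsP; exact: cc_scaleDr.
Qed.

Lemma pscaleDl x : {morph pscale^~ x : a b / a + b}.
Proof.
move=> a b; elim/pclsW: x => s /=.
rewrite !pcls_scale [RHS]pcls_add.
by apply/pclsP; exact: cc_scaleDl.
Qed.

HB.instance Definition _ := GRing.Zmodule_isLmodule.Build rat presented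
  pscaleA pscale1 pscaleDr pscaleDl.

Lemma pclsD s t : pcls (tadd s t) = pcls s + pcls t.
Proof. by rewrite -pcls_add. Qed.
Lemma pclsN s : pcls (topp s) = - pcls s.
Proof. by rewrite -pcls_opp. Qed.
Lemma pclsZ a s : pcls (tscale a s) = a *: pcls s.
Proof. by rewrite -pcls_scale. Qed.
Lemma pclsM o s t : pcls (tbin o s t) = pop o (pcls s) (pcls t).
Proof. by rewrite -pcls_op. Qed.
Lemma pcls0 : pcls tzero = 0.
Proof. by []. Qed.
Definition pclsE := (pclsD, pclsN, pclsZ, pclsM, pcls0).

Lemma pop_linearl o y : linear (pop o ^~ y).
Proof.
move=> a; elim/pclsW=> s; elim/pclsW=> s'; elim/pclsW: y => t.
by have /pclsP := cc_opPl ax o a s s' t; rewrite !pclsE.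
Qed.

Lemma pop_linearr o x : linear (pop o x).
Proof.
move=> a; elim/pclsW=> t; elim/pclsW=> t'; elim/pclsW: x => s.
by have /pclsP := cc_opPr ax o a s t t'; rewrite !pclsE.
Qed.

Section UniversalProperty.
Variables (V : lmodType rat) (m : O -> V -> V -> V) (f : G -> V).

Fixpoint teval (t : term O G) : V :=
  match t with
  | tgen g => f g
  | tzero => 0
  | tadd s t => teval s + teval t
  | topp s => - teval s
  | tscale a s => a *: teval s
  | tbin o s t => m o (teval s) (teval t)
  end.

Definition peval (x : presented) : V := teval (prep x).

Hypothesis m_linearl : forall o y, linear (m o ^~ y).
Hypothesis m_linearr : forall o x, linear (m o x).
Hypothesis f_ax : forall s t, ax s t -> teval s = teval t.

Lemma teval_congr s t : congr_closure ax s t -> teval s = teval t.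
Proof.
elim=> {s t} /=.
- exact: f_ax.
- by [].
- by move=> s t _ ->.
- by move=> t s u _ -> _ ->.
- by move=> s s' t t' _ -> _ ->.
- by move=> s s' _ ->.
- by move=> a s s' _ ->.
- by move=> o s s' t t' _ -> _ ->.
- by move=> *; rewrite addrA.
- by move=> *; rewrite addrC.
- by move=> *; rewrite add0r.
- by move=> *; rewrite addNr.
- by move=> *; rewrite scalerA.
- by move=> *; rewrite scale1r.
- by move=> *; rewrite scalerDr.
- by move=> *; rewrite scalerDl.
- by move=> *; rewrite m_linearl.
- by move=> *; rewrite m_linearr.
Qed.

Lemma peval_pcls s : peval (pcls s) = teval s.
Proof. exact/teval_congr/prep_pcls. Qed.

Lemma peval_gen g : peval (pgen g) = f g.
Proof. exact: peval_pcls. Qed.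

Lemma peval_linear : linear peval.
Proof.
move=> a; elim/pclsW=> s; elim/pclsW=> t.
by rewrite -pclsZ -pclsD !peval_pcls.
Qed.

Lemma peval_op o x y : peval (pop o x y) = m o (peval x) (peval y).
Proof.
by elim/pclsW: x => s; elim/pclsW: y => t; rewrite -pclsM !peval_pcls.
Qed.

Lemma peval_unique (F : presented -> V) : linear F ->
  (forall o x y, F (pop o x y) = m o (F x) (F y)) ->
  (forall g, F (pgen g) = f g) -> F =1 peval.
Proof.
move=> Flin Fop Fgen; elim/pclsW=> s; rewrite peval_pcls.
have F0 : F 0 = 0.
  by have := Flin (-1) 0 0; rewrite scaler0 addr0 scaleN1r addNr.
have FZ a x : F (a *: x) = a *: F x.
  by rewrite -[a *: x]addr0 Flin F0 addr0.
elim: s => [g||s IHs t IHt|s IHs|a s IHs|o s IHs t IHt] /=; rewrite ?pclsE.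
- exact: Fgen.
- exact: F0.
- by rewrite -[pcls s]scale1r Flin scale1r IHs IHt.
- by rewrite -[- pcls s]scaleN1r FZ scaleN1r IHs.
- by rewrite FZ IHs.
- by rewrite Fop IHs IHt.
Qed.

End UniversalProperty.
End Presented.

Inductive tensor_ax (Y : zmodType) : term void Y -> term void Y -> Prop :=
| tensor_add (y z : Y) :
    tensor_ax (tgen (y + z)) (tadd (tgen y) (tgen z)).

Definition rat_tensor (Y : zmodType) : lmodType rat := presented (@tensor_ax Y).

(* [a *: one_tensor y] is the pure tensor of [a] and [y]. *)
Definition one_tensor (Y : zmodType) (y : Y) : rat_tensor Y :=
  pgen (@tensor_ax Y) y.

(* The Q-linear map with [one_tensor y |-> f y], for additive [f]. *)
Definition rat_tensor_lift (Y : zmodType) (V : lmodType rat) (f : Y -> V) :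
    rat_tensor Y -> V :=
  peval (fun o : void => match o with end) f.

Lemma one_tensorD (Y : zmodType) : {morph @one_tensor Y : y z / y + z}.
Proof.
by move=> y z; have /cc_ax/pclsP := tensor_add y z; rewrite pclsE.
Qed.

Section RatTensorLift.
Variables (Y : zmodType) (V : lmodType rat) (f : {additive Y -> V}).

Lemma rat_tensor_lift_gen y : rat_tensor_lift f (one_tensor y) = f y.
Proof. by apply: peval_gen => [[]|[]|_ _ [{}y z]]//=; exact: raddfD. Qed.

Lemma rat_tensor_lift_linear : linear (rat_tensor_lift f).
Proof. by apply: peval_linear => [[]|[]|_ _ [y z]]//=; exact: raddfD. Qed.

End RatTensorLift.

HB.mixin Record isLieAlgebra (K : pzRingType) L of GRing.Lmodule K L := {
  bracket : L -> L -> L;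
  bracket_linearl : forall y, linear (bracket ^~ y);
  bracket_linearr : forall x, linear (bracket x);
  bracketxx : forall x, bracket x x = 0;
  bracket_jacobi : forall x y z,
    bracket x (bracket y z) + bracket y (bracket z x) +
    bracket z (bracket x y) = 0
}.

#[short(type="lieAlgType")]
HB.structure Definition LieAlgebra (K : pzRingType) :=
  { L of isLieAlgebra K L & GRing.Lmodule K L }.

Section PresentedLie.
Variables (G : Type) (rel : term unit G -> term unit G -> Prop).

Inductive lie_ax : term unit G -> term unit G -> Prop :=
| lie_rel s t : rel s t -> lie_ax s t
| lie_alt s : lie_ax (tbin tt s s) tzero
| lie_jacobi s t u :
    lie_ax (tadd (tadd (tbin tt s (tbin tt t u)) (tbin tt t (tbin tt u s)))
                 (tbin tt u (tbin tt s t)))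
           tzero.

(* The Lie algebra over Q generated by [G] subject to the relations [rel]. *)
Definition lie_presented : Type := presented lie_ax.
HB.instance Definition _ := GRing.Lmodule.on lie_presented.

Definition lie_bracket (x y : lie_presented) : lie_presented :=
  @pop _ _ lie_ax tt x y.

Lemma lie_bracketxx x : lie_bracket x x = 0.
Proof.
by elim/pclsW: x => s; have /cc_ax/pclsP := lie_alt s; rewrite !pclsE.
Qed.

Lemma lie_bracket_jacobi x y z :
  lie_bracket x (lie_bracket y z) + lie_bracket y (lie_bracket z x) +
  lie_bracket z (lie_bracket x y) = 0.
Proof.
elim/pclsW: x => s; elim/pclsW: y => t; elim/pclsW: z => u.
by have /cc_ax/pclsP := lie_jacobi s t u; rewrite !pclsE.
Qed.

HB.instance Definition _ := isLieAlgebra.Build rat lie_presented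
  (@pop_linearl _ _ lie_ax tt) (@pop_linearr _ _ lie_ax tt)
  lie_bracketxx lie_bracket_jacobi.

Definition lie_gen (g : G) : lie_presented := pgen lie_ax g.

Section Lift.
Variables (L : lieAlgType rat) (f : G -> L).
Hypothesis f_rel : forall s t, rel s t ->
  teval (fun=> bracket) f s = teval (fun=> bracket) f t.

Definition lie_lift : lie_presented -> L := peval (fun=> bracket) f.

Let gen_ax s t : lie_ax s t ->
  teval (fun=> bracket) f s = teval (fun=> bracket) f t.
Proof.
case=> [{}s {}t /f_rel //|{}s|{}s {}t u] /=.
- exact: bracketxx.
- exact: bracket_jacobi.
Qed.

Lemma lie_lift_gen g : lie_lift (lie_gen g) = f g.
Proof.
by apply: peval_gen gen_ax _ => _;
  [exact: bracket_linearl | exact: bracket_linearr].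
Qed.

Lemma lie_lift_linear : linear lie_lift.
Proof.
by apply: peval_linear gen_ax => _;
  [exact: bracket_linearl | exact: bracket_linearr].
Qed.

Lemma lie_lift_bracket x y :
  lie_lift (bracket x y) = bracket (lie_lift x) (lie_lift y).
Proof.
by apply: peval_op gen_ax _ _ _ => _;
  [exact: bracket_linearl | exact: bracket_linearr].
Qed.

Lemma lie_lift_unique (F : {linear lie_presented -> L}) :
  (forall x y, F (bracket x y) = bracket (F x) (F y)) ->
  (forall g, F (lie_gen g) = f g) -> F =1 lie_lift.
Proof.
move=> Fbr Fgen; apply: peval_unique => //.
- by move=> _; exact: bracket_linearl.
- by move=> _; exact: bracket_linearr.
- by move=> a x y; rewrite linearP.
- by move=> []; exact: Fbr.
Qed.

End Lift.

End PresentedLie.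

Section Enveloping.
Variable L : lieAlgType rat.

(* The generator [None] stands for the unit. *)
Inductive env_ax : term unit (option L) -> term unit (option L) -> Prop :=
| env_mulA s t u : env_ax (tbin tt s (tbin tt t u)) (tbin tt (tbin tt s t) u)
| env_mul1l s : env_ax (tbin tt (tgen None) s) s
| env_mul1r s : env_ax (tbin tt s (tgen None)) s
| env_linear a x y :
    env_ax (tgen (Some (a *: x + y)))
           (tadd (tscale a (tgen (Some x))) (tgen (Some y)))
| env_bracket x y :
    env_ax (tgen (Some (bracket x y)))
           (tadd (tbin tt (tgen (Some x)) (tgen (Some y)))
                 (topp (tbin tt (tgen (Some y)) (tgen (Some x))))).

Definition enveloping : Type := presented env_ax.
HB.instance Definition _ := GRing.Lmodule.on enveloping.

Definition env_one : enveloping := pgen env_ax None.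
Definition env_mul (u v : enveloping) : enveloping := @pop _ _ env_ax tt u v.

Lemma env_mulrA : associative env_mul.
Proof.
elim/pclsW=> s; elim/pclsW=> t; elim/pclsW=> u.
by have /cc_ax/pclsP := env_mulA s t u; rewrite !pclsE.
Qed.

Lemma env_mul1r_ : left_id env_one env_mul.
Proof.
by elim/pclsW=> s; have /cc_ax/pclsP := env_mul1l s; rewrite !pclsE.
Qed.

Lemma env_mulr1_ : right_id env_one env_mul.
Proof.
by elim/pclsW=> s; have /cc_ax/pclsP := env_mul1r s; rewrite !pclsE.
Qed.

Lemma env_scalerAl a u v : a *: env_mul u v = env_mul (a *: u) v.
Proof.
have lin0 : env_mul 0 v = 0.
  by have := pop_linearl tt v (-1) 0 0;
     rewrite scaler0 addr0 scaleN1r addNr.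
by rewrite -[a *: u]addr0 [RHS]pop_linearl [X in _ + X]lin0 addr0.
Qed.

Lemma env_scalerAr a u v : a *: env_mul u v = env_mul u (a *: v).
Proof.
have lin0 : env_mul u 0 = 0.
  by have := pop_linearr tt u (-1) 0 0;
     rewrite scaler0 addr0 scaleN1r addNr.
by rewrite -[a *: v]addr0 [RHS]pop_linearr [X in _ + X]lin0 addr0.
Qed.

Lemma env_mulrDl : left_distributive env_mul +%R.
Proof.
move=> u v w; have := pop_linearl tt w 1 u v.
by rewrite !scale1r.
Qed.

Lemma env_mulrDr : right_distributive env_mul +%R.
Proof.
move=> u v w; have := pop_linearr tt u 1 v w.
by rewrite !scale1r.
Qed.

(* The augmentation of the enveloping algebra separates 1 from 0. *)
Lemma env_one_neq0 : env_one != 0.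
Proof.
apply/eqP => one0.
pose ev := @peval _ _ env_ax rat^o (fun=> *%R)
  (fun o => if o is Some _ then 0 else 1).
have evcls s : ev (pcls _ s) = teval (fun=> *%R)
    (fun o => if o is Some _ then 0 else 1 : rat^o) s.
  apply: peval_pcls => [_ y a x z|_ x a y z|{}s t].
  - by rewrite mulrDl -scalerAl.
  - by rewrite mulrDr -scalerAr.
  - case=> /=.
    + by move=> *; rewrite mulrA.
    + by move=> *; rewrite mul1r.
    + by move=> *; rewrite mulr1.
    + by move=> *; rewrite scaler0 addr0.
    + by move=> *; rewrite mul0r subr0.
have : ev env_one = ev 0 by rewrite one0.
have -> : 0 = pcls env_ax tzero by [].
by rewrite !evcls /= => /eqP; rewrite oner_eq0.
Qed.

HB.instance Definition _ := GRing.Zmodule_isNzRing.Build enveloping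
  env_mulrA env_mul1r_ env_mulr1_ env_mulrDl env_mulrDr env_one_neq0.
HB.instance Definition _ :=
  GRing.Lmodule_isLalgebra.Build rat enveloping env_scalerAl.
HB.instance Definition _ :=
  GRing.Lalgebra_isAlgebra.Build rat enveloping env_scalerAr.

Definition env_inj (x : L) : enveloping := pgen env_ax (Some x).

Lemma env_inj_linear : linear env_inj.
Proof.
by move=> a x y; have /cc_ax/pclsP := env_linear a x y; rewrite !pclsE.
Qed.

Lemma env_inj_bracket x y :
  env_inj (bracket x y) = env_inj x * env_inj y - env_inj y * env_inj x.
Proof.
by have /cc_ax/pclsP := env_bracket x y; rewrite !pclsE.
Qed.

Section Lift.
Variables (A : algType rat) (f : {linear L -> A}).
Hypothesis f_bracket : forall x y, f (bracket x y) = f x * f y - f y * f x.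

Definition env_lift : enveloping -> A :=
  peval (fun=> *%R) (fun o => if o is Some x then f x else 1).

Let mul_linearl (o : unit) (y : A) : linear (fun x : A => x * y).
Proof. by move=> a x z; rewrite mulrDl scalerAl. Qed.

Let mul_linearr (o : unit) (x : A) : linear (fun y : A => x * y).
Proof. by move=> a y z; rewrite mulrDr scalerAr. Qed.

Let gen_ax s t : env_ax s t ->
  teval (fun=> *%R) (fun o => if o is Some x then f x else 1) s =
  teval (fun=> *%R) (fun o => if o is Some x then f x else 1) t :> A.
Proof.
case=> /=.
- by move=> *; rewrite mulrA.
- by move=> *; rewrite mul1r.
- by move=> *; rewrite mulr1.
- by move=> a x y; rewrite linearP.
- by move=> x y; rewrite f_bracket.
Qed.

Lemma env_lift_inj x : env_lift (env_inj x) = f x.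
Proof. exact: peval_gen. Qed.

Lemma env_lift_linear : linear env_lift.
Proof. exact: peval_linear. Qed.

Lemma env_lift_monoid_morphism : monoid_morphism env_lift.
Proof. by split=> [|u v]; [exact: peval_gen | exact: peval_op]. Qed.

Lemma env_lift_unique (F : {lrmorphism enveloping -> A}) :
  (forall x, F (env_inj x) = f x) -> F =1 env_lift.
Proof.
move=> Ff; apply: peval_unique => //.
- by move=> a u v; rewrite linearP.
- by move=> [] u v; exact: (rmorphM F).
- by case=> [x|]; [exact: Ff | exact: (rmorph1 F)].
Qed.

End Lift.
End Enveloping.

(* The form on Z[I] is given by its values on the basis [I]. *)
Record cartanDatum (I : finType) := CartanDatum {
  cform : I -> I -> int;
  cform_sym : forall i j, cform i j = cform j i;
  cform_diag : forall i, exists n : nat, cform i i = (n.+1.*2)%:Z;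
  cform_offdiag : forall i j, i != j -> exists n : nat,
    2 * (cform i j)%:Q / (cform i i)%:Q = - n%:R
}.

Definition finite_type (I : finType) (C : cartanDatum I) : Prop :=
  forall v : {ffun I -> rat}, v != 0 ->
    0 < \sum_i \sum_j v i * (cform C i j)%:Q * v j.

Definition fg_free (M : zmodType) : Prop :=
  exists n (b : 'I_n -> M), forall m, exists! c : {ffun 'I_n -> int},
    m = \sum_i b i *~ c i.

Record rootDatum (I : finType) (C : cartanDatum I) := RootDatum {
  wlat : zmodType;
  cwlat : zmodType;
  wlat_fg_free : fg_free wlat;
  cwlat_fg_free : fg_free cwlat;
  rpair : cwlat -> wlat -> int;
  rpairDl : forall x, {morph rpair ^~ x : y z / y + z};
  rpairDr : forall y, {morph rpair y : x z / x + z};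
  rpair_perfectl : forall f : {additive wlat -> int},
    exists! y, forall x, rpair y x = f x;
  rpair_perfectr : forall f : {additive cwlat -> int},
    exists! x, forall y, rpair y x = f y;
  coroot : I -> cwlat;
  sroot : I -> wlat;
  coroot_inj : injective coroot;
  sroot_inj : injective sroot;
  rpair_coroot_root : forall i j,
    (rpair (coroot i) (sroot j))%:Q = 2 * (cform C i j)%:Q / (cform C i i)%:Q
}.

Section RootDatum.
Variables (I : finType) (C : cartanDatum I) (D : rootDatum C).

Local Notation X := (wlat D).
Local Notation Y := (cwlat D).
Local Notation "<< y , l >>" := (rpair y l).

Definition simple_refl (i : I) (l : X) : X :=
  l - sroot D i *~ << coroot D i, l >>.

(* The group of permutations of [X] generated by the simple reflections. *)
Inductive weyl_group : (X -> X) -> Prop :=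
| weyl_refl i : weyl_group (simple_refl i)
| weyl_id : weyl_group id
| weyl_comp w w' : weyl_group w -> weyl_group w' -> weyl_group (w \o w')
| weyl_inv w w' :
    weyl_group w -> cancel w w' -> cancel w' w -> weyl_group w'.

Definition root_le (l l' : X) : Prop :=
  exists c : I -> nat, l' - l = \sum_i sroot D i *+ c i.

Definition dominant : set X := [set l | forall i, 0 <= << coroot D i, l >>].

Definition saturated (pi : set X) : Prop :=
  forall l l', pi l -> dominant l' -> root_le l' l -> pi l'.

Definition weyl_orbits (pi : set X) : set X :=
  [set l | exists w l0, [/\ weyl_group w, pi l0 & l = w l0]].

Definition cartan_sub : lmodType rat := rat_tensor Y.

Definition hpair (h : cartan_sub) (l : X) : rat :=
  rat_tensor_lift (fun y => << y, l >>%:Q : rat^o) h.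

Lemma hpair_one_tensor y l : hpair (one_tensor y) l = << y, l >>%:Q.
Proof.
apply: (@peval_gen _ _ _ rat^o) => [[]|[]|_ _ [y1 y2]] //=.
by rewrite rpairDl intrD.
Qed.

Lemma hpair_linear l : linear (hpair ^~ l : cartan_sub -> rat^o).
Proof.
apply: peval_linear => [[]|[]|_ _ [y1 y2]] //=.
by rewrite rpairDl intrD.
Qed.

Variant chevalley : Type :=
| gen_h of cartan_sub
| gen_e of I
| gen_f of I.

Local Notation H h := (tgen (gen_h h)).
Local Notation E i := (tgen (gen_e i)).
Local Notation F i := (tgen (gen_f i)).
Local Notation br := (tbin tt).

Variant serre_rel : term unit chevalley -> term unit chevalley -> Prop :=
| serre_linear a h h' :
    serre_rel (H (a *: h + h')) (tadd (tscale a (H h)) (H h'))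
| serre_hh h h' : serre_rel (br (H h) (H h')) tzero
| serre_he h i :
    serre_rel (br (H h) (E i)) (tscale (hpair h (sroot D i)) (E i))
| serre_hf h i :
    serre_rel (br (H h) (F i)) (tscale (- hpair h (sroot D i)) (F i))
| serre_ef i : serre_rel (br (E i) (F i)) (H (one_tensor (coroot D i)))
| serre_ef0 i j : i != j -> serre_rel (br (E i) (F j)) tzero
| serre_ee i j : i != j -> serre_rel
    (iter `|1 - << coroot D i, sroot D j >>|%N (br (E i)) (E j)) tzero
| serre_ff i j : i != j -> serre_rel
    (iter `|1 - << coroot D i, sroot D j >>|%N (br (F i)) (F j)) tzero.

Definition root_lie : lieAlgType rat := lie_presented serre_rel.

Definition UEA : algType rat := enveloping root_lie.

Definition cartan_UEA (h : cartan_sub) : UEA :=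
  env_inj (lie_gen serre_rel (gen_h h)).

Definition weight_space (V : lmodType UEA) (l : X) : set V :=
  [set m | forall h, cartan_UEA h *: m = (hpair h l)%:A *: m].

(* [V] is the direct sum of the weight spaces [V_l], [l \in P]. *)
Definition weight_sum (P : set X) (V : lmodType UEA) : Prop :=
  forall m : V, exists! c : {fsfun X -> V with 0},
    [/\ forall l, weight_space l (c l),
        forall l, l \in finsupp c -> P l &
        m = \sum_(l <- finsupp c) c l].

Definition in_C (V : lmodType UEA) : Prop := weight_sum setT V.

Definition in_C_pi (pi : set X) (V : lmodType UEA) : Prop :=
  in_C V /\ weight_sum (weyl_orbits pi) V.

Definition defining_ideal (pi : set X) : set UEA :=
  [set u | forall V : lmodType UEA, in_C_pi pi V -> forall m : V, u *: m = 0].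

(* [fset_set] is meaningful on finite sets only: [weyl_orbits pi] is finite
   because [pi] and the Weyl group are.  The factors commute, so the order in
   which they are listed is immaterial. *)
Definition schur_rel (pi : set X) (y : Y) : UEA :=
  \prod_(l <- fset_set (weyl_orbits pi))
    (cartan_UEA (one_tensor y) - << y, l >>%:~R).

End RootDatum.

Definition two_sided_ideal (A : pzRingType) (J : set A) : Prop :=
  [/\ J 0, forall u v, J u -> J v -> J (u + v),
      forall a u, J u -> J (a * u) & forall a u, J u -> J (u * a)].

Definition ideal_generated (A : pzRingType) (S : set A) : set A :=
  smallest (@two_sided_ideal A) S.

(* Main.v *)
Require Import Defs.
From HB Require Import structures.
From mathcomp Require Import all_boot all_order all_algebra finmap.
From mathcomp Require Import ring lra zify.
From mathcomp Require Import boolp classical_sets cardinality.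

Set Implicit Arguments.
Unset Strict Implicit.
Unset Printing Implicit Defensive.

Import Order.TTheory GRing.Theory Num.Theory.

Local Open Scope classical_set_scope.
Local Open Scope ring_scope.

(** Write [P] for the union of the Weyl orbits of [pi] and [J] for the ideal
    generated by the products [prod_(l in P) (y - <y, l>)], [y in Y].

    The set [P] is finite.  The Weyl group preserves the length of a weight,
    so the difference of two weights in one orbit is an integral combination
    [c] of simple roots, and [c] lies on an ellipsoid for the Cartan form, which
    is positive definite: such [c] are bounded ([weyl_orbits_finite]).
    In particular the products above are indexed by all of [P].

    [J] annihilates each module [V] of [C[pi]], because [V] is spanned by
    weight vectors with weights in [P], and on a weight vector of weight [l] the
    product attached to [y] acts by a scalar with the factor
    [<y, l> - <y, l>] ([defining_ideal_schur_rel]).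

    Conversely, the left module [U / J] belongs to [C[pi]]
    ([in_C_pi_killed]).  An element that annihilates every object of [C[pi]]
    then annihilates the class of [1] in [U / J], hence lies in [J].  What has
    to be seen is that a module [V] on which all the products vanish is the sum
    of its weight spaces for weights in [P].  Choose [y0 in Y] taking distinct
    values on [P]; the product attached to [y0] has simple roots, so [V] is the
    direct sum of the eigenspaces of [y0] for the values [<y0, l>], with the
    Lagrange interpolation polynomials in [y0] as projectors
    ([exists_weight_sum]).  The eigenspace for [<y0, l>] is the weight space of
    [l]: let [w] be in it and [y in Y].  The products attached to [y] and to
    [N y0 + y] both kill [w]; as polynomials in [y], the first has the roots
    [<y, k>] and the second has the roots [<y, m> - N <y0, l - m>], for [k] and
    [m] in [P].  For [N] large their only common root is [<y, l>], with
    multiplicity one in the second, so that [y w = <y, l> w]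
    ([eigen_weight]).  It matters here that [J] contains the products
    attached to all [y in Y], and not only to a basis of [Y]. *)

(** * Generic elements *)

(** The progression [p.1 + p.2 N] vanishes for at most one [N], and not for
    an [N] beyond [|p.1|]. *)
Lemma exists_avoid (s : seq (int * int)) :
  exists N : nat, forall p, p \in s -> p.2 != 0 -> p.1 + p.2 *+ N != 0.
Proof.
exists (\max_(p <- s) `|p.1|%N).+1 => -[u d] /= ps d0.
have : (`|u| <= \max_(p <- s) `|p.1|)%N.
  exact: (leq_bigmax_seq (r := s) (P := xpredT) (F := fun p => `|p.1|%N)
            (u, d)).
set M := \max_(p <- s) _ => uM.
apply/eqP => /eqP; rewrite addr_eq0 => /eqP uE.
have : `|u|%N = (`|d| * M.+1)%N by rewrite uE abszN -mulr_natr abszM natz.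
have : (0 < `|d|)%N by rewrite absz_gt0.
nia.
Qed.

(** [<y, d> = 0] cuts out a proper subgroup for each [d <> 0], and finitely
    many of those do not exhaust [Y]: if [y] avoids the subgroups of [ds] but
    lies in that of [d], and [z] avoids that of [d], then some [z + N y] avoids
    all of them. *)
Lemma exists_nonvanishing (Y T : zmodType) (b : Y -> T -> int)
    (bDl : forall d, {morph b ^~ d : y z / y + z})
    (b_nondeg : forall d, d != 0 -> exists y, b y d != 0) (ds : seq T) :
  exists y, forall d, d \in ds -> d != 0 -> b y d != 0.
Proof.
have bMn y d n : b (y *+ n) d = b y d *+ n.
  have b0 : b 0 d = 0.
    by apply: (addrI (b 0 d)); rewrite -bDl !addr0.
  by elim: n => [|n IHn]; rewrite ?mulr0n // !mulrS bDl IHn.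
elim: ds => [|d ds [y yP]]; first by exists 0.
have [d0|d0] := eqVneq d 0.
  exists y => d'; rewrite inE => /predU1P[->|d'ds]; last exact: yP.
  by rewrite d0 eqxx.
have [z zP] := b_nondeg d d0.
have [byd|byd] := eqVneq (b y d) 0; last first.
  exists y => d'; rewrite inE => /predU1P[->//|]; exact: yP.
have [N NP] := exists_avoid [seq (b z d', b y d') | d' <- ds].
exists (z + y *+ N) => d'; rewrite inE bDl bMn => /predU1P[->|d'ds] d'0.
  by rewrite byd mul0rn addr0.
exact: (NP (b z d', b y d') (map_f _ d'ds) (yP _ d'ds d'0)).
Qed.

(** * Lagrange interpolation *)

Section Lagrange.
Variables (F : fieldType) (T : eqType) (f : T -> F) (s : seq T).

(** The nodes are the values [f l], [l in s]; only the nodes of [s] other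
    than [l] enter, so that no division by zero occurs when [f] is injective on
    [s]. *)
Definition lagrange (l : T) : {poly F} :=
  (\prod_(m <- s | m != l) (f l - f m))^-1 *:
    \prod_(m <- s | m != l) ('X - (f m)%:P).

Hypothesis s_uniq : uniq s.

(** If an operator is a root of the product on the right, then [lagrange l]
    in that operator maps into its eigenspace for [f l]. *)
Lemma XsubC_lagrange l : l \in s -> exists c,
  ('X - (f l)%:P) * lagrange l = c *: \prod_(m <- s) ('X - (f m)%:P).
Proof.
move=> ls; exists (\prod_(m <- s | m != l) (f l - f m))^-1.
by rewrite [in RHS](bigD1_seq l) //= -scalerAr.
Qed.

Hypothesis f_inj : {in s &, injective f}.

Lemma lagrangeE l m : l \in s -> m \in s -> (lagrange l).[f m] = (l == m)%:R.
Proof.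
move=> ls ms; rewrite hornerZ horner_prod.
have [<-|lm] := eqVneq l m.
  under [X in _ * X]eq_bigr do rewrite hornerXsubC.
  rewrite mulVf // prodf_seq_neq0; apply/allP => k ks; apply/implyP => kl.
  by rewrite subr_eq0; apply: contra_neq kl => /f_inj -> //.
rewrite [X in _ * X](big_rem m) //= eq_sym lm.
by rewrite hornerXsubC subrr mul0r mulr0.
Qed.

(** The difference of the two sides has degree less than [size s] and vanishes
    at the [size s] nodes. *)
Lemma sum_lagrange : (0 < size s)%N -> \sum_(l <- s) lagrange l = 1.
Proof.
move=> s_gt0; apply/eqP; rewrite -subr_eq0; apply/eqP.
apply: (@roots_geq_poly_eq0 _ _ (map f s)).
- apply/allP => _ /mapP[m ms ->].
  rewrite /root hornerD hornerN hornerC horner_sum (bigD1_seq m) //=.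
  rewrite lagrangeE // eqxx big1_seq ?addr0 ?subrr // => l /andP[lm ls].
  by rewrite lagrangeE // (negPf lm).
- by rewrite map_inj_in_uniq.
rewrite size_map (leq_trans (size_polyD _ _)) // geq_max size_polyN.
rewrite size_polyC oner_eq0 s_gt0 andbT.
apply: (leq_trans (size_sum _ _ _)); apply/bigmax_leqP_seq => l ls _.
apply: (leq_trans (size_scale_leq _ _)).
rewrite -big_filter size_prod_XsubC -rem_filter // size_rem //.
by rewrite prednK // -?has_predT; case: (s) ls.
Qed.

End Lagrange.

(** * Polynomials in an element of an algebra, acting on a module *)

Lemma coprimep_prod_XsubC (F : fieldType) (T : eqType) (f : T -> F) (s : seq T)
    (p : {poly F}) :
  (forall l, l \in s -> ~~ root p (f l)) ->
  coprimep p (\prod_(l <- s) ('X - (f l)%:P)).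
Proof.
elim: s => [|l s IHs] sP; first by rewrite big_nil coprimep1.
rewrite big_cons coprimepMr coprimep_XsubC sP ?mem_head //=.
by apply: IHs => m ms; apply: sP; rewrite inE ms orbT.
Qed.

Section PolyAction.
Variables (F : fieldType) (A : algType F) (V : lmodType A).
Implicit Types (a b : A) (v : V) (p q : {poly F}) (x : F).

Lemma scaleAC a x v : a *: (x%:A *: v) = x%:A *: (a *: v).
Proof. by rewrite !scalerA -scalerAl -scalerAr mulr1 mul1r. Qed.

Lemma horner_alg_eigen a x v p : a *: v = x%:A *: v ->
  horner_alg a p *: v = p.[x]%:A *: v.
Proof.
move=> av; elim/poly_ind: p => [|p c IHp].
  by rewrite rmorph0 horner0 !scale0r.
rewrite rmorphD rmorphM /= horner_algX horner_algC hornerMXaddC.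
rewrite !scalerDl -scalerA av; congr (_ + _).
by rewrite scaleAC IHp scalerA -scalerAl mul1r scalerA mulrC.
Qed.

(** On an eigenvector of [a] for [x], the element [a + b] acts as [x + b].
    Each step of the induction on [p] replaces [v] by [(a + b) v], which is
    again an eigenvector of [a] because [a] and [b] commute. *)
Lemma horner_alg_shift a b x v p : GRing.comm a b -> a *: v = x%:A *: v ->
  horner_alg (a + b) p *: v = horner_alg b (p \Po ('X + x%:P)) *: v.
Proof.
move=> ab; elim/poly_ind: p v => [|p c IHp] v av.
  by rewrite comp_poly0 !rmorph0 !scale0r.
rewrite comp_polyD comp_polyM comp_polyX comp_polyC.
rewrite !rmorphD !rmorphM /= !rmorphD /= !horner_algX !horner_algC.
rewrite [LHS]scalerDl [RHS]scalerDl; congr (_ + _).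
have e : (a + b) *: v = (b + x%:A) *: v by rewrite !scalerDl av addrC.
rewrite -!scalerA e; apply: IHp.
by rewrite scalerDl !scalerDr (scalerA a b) ab -(scalerA b a) av !scaleAC av.
Qed.

Lemma coprimep_horner_alg_eq0 a p q v : coprimep p q ->
  horner_alg a p *: v = 0 -> horner_alg a q *: v = 0 -> v = 0.
Proof.
case/Bezout_eq1_coprimepP => -[r t] /= rt pv qv.
rewrite -[v]scale1r -(rmorph1 (horner_alg a)) -rt rmorphD !rmorphM /=.
by rewrite scalerDl -!scalerA pv qv !scaler0 addr0.
Qed.

End PolyAction.

(** * Quotients by an ideal *)

Section IdealQuotient.
Variables (A : pzRingType) (J : set A) (J_ideal : two_sided_ideal J).

(** The proof argument keeps the additive structure, which depends on it,
    attached to this predicate. *)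
Definition ideal_pred (_ : two_sided_ideal J) : {pred A} := fun u => `[< J u >].

Lemma ideal_pred_zmod_closed : zmod_closed (ideal_pred J_ideal).
Proof.
have [J0 JD JMl _] := J_ideal; split=> [|u v /asboolP Ju /asboolP Jv].
  exact/asboolP.
by apply/asboolP/JD; rewrite // -mulN1r; exact: JMl.
Qed.

HB.instance Definition _ :=
  GRing.isZmodClosed.Build A (ideal_pred J_ideal) ideal_pred_zmod_closed.

Definition ideal_quotient := Quotient.quot (ideal_pred J_ideal).
HB.instance Definition _ := GRing.Zmodule.on ideal_quotient.

Definition ideal_class (u : A) : ideal_quotient :=
  \pi_(Quotient.quot (ideal_pred J_ideal))%qT u.

Lemma ideal_classB : zmod_morphism ideal_class.
Proof. by move=> u v; rewrite /ideal_class raddfB. Qed.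

HB.instance Definition _ :=
  GRing.isZmodMorphism.Build A ideal_quotient ideal_class ideal_classB.

Lemma ideal_class_surj x : exists u, x = ideal_class u.
Proof. by exists (repr x); rewrite /ideal_class reprK. Qed.

Lemma ideal_class_eq0 u : ideal_class u = 0 <-> J u.
Proof.
rewrite -(raddf0 ideal_class).
have := Quotient.idealrBE (ideal_pred J_ideal) u 0; rewrite subr0 => uE.
split=> [/eqP|Ju]; first by rewrite -uE => /asboolP.
by apply/eqP; rewrite -uE; exact/asboolP.
Qed.

Definition ideal_scale (a : A) (x : ideal_quotient) : ideal_quotient :=
  ideal_class (a * repr x).

Lemma ideal_scaleE a u : ideal_scale a (ideal_class u) = ideal_class (a * u).
Proof.
have [_ _ JMl _] := J_ideal.
apply/eqP; rewrite -subr_eq0 -raddfB -mulrBr; apply/eqP/ideal_class_eq0/JMl.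
by apply/ideal_class_eq0; rewrite raddfB /= {1}/ideal_class reprK subrr.
Qed.

Lemma ideal_scaleA a b x :
  ideal_scale a (ideal_scale b x) = ideal_scale (a * b) x.
Proof. by have [u ->] := ideal_class_surj x; rewrite !ideal_scaleE mulrA. Qed.

Lemma ideal_scale1 : left_id 1 ideal_scale.
Proof.
by move=> x; have [u ->] := ideal_class_surj x; rewrite ideal_scaleE mul1r.
Qed.

Lemma ideal_scaleDr : right_distributive ideal_scale +%R.
Proof.
move=> a x x'; have [u ->] := ideal_class_surj x.
have [u' ->] := ideal_class_surj x'.
by rewrite -raddfD !ideal_scaleE mulrDr raddfD.
Qed.

Lemma ideal_scaleDl x : {morph ideal_scale^~ x : a b / a + b}.
Proof.
move=> a b; have [u ->] := ideal_class_surj x.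
by rewrite !ideal_scaleE mulrDl raddfD.
Qed.

HB.instance Definition _ := GRing.Zmodule_isLmodule.Build A ideal_quotient
  ideal_scaleA ideal_scale1 ideal_scaleDr ideal_scaleDl.

Lemma ideal_classZ a u : a *: ideal_class u = ideal_class (a * u).
Proof. exact: ideal_scaleE. Qed.

End IdealQuotient.

(** * Weights *)

Lemma rat_tensor_ind (Y : zmodType) (P : rat_tensor Y -> Prop) :
  P 0 -> (forall a u v, P u -> P v -> P (a *: u + v)) ->
  (forall y, P (one_tensor y)) -> forall u, P u.
Proof.
move=> P0 Plin Pgen; elim/pclsW; elim=> [y||s IHs t IHt|s IHs|a s IHs|[]] //=.
- exact: Pgen.
- by rewrite pclsD -[pcls _ s]scale1r; exact: Plin.
- by rewrite pclsN -scaleN1r -[_ *: _]addr0; exact: Plin.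
- by rewrite pclsZ -[_ *: _]addr0; exact: Plin.
Qed.

Section Weights.
Variables (I : finType) (C : cartanDatum I) (D : rootDatum C).
Local Notation X := (wlat D).
Local Notation Y := (cwlat D).
Local Notation U := (UEA D).
Local Notation "<< y , l >>" := (rpair y l).
Implicit Types (y z : Y) (l m : X).

Lemma cartan_UEA_linear : linear (@cartan_UEA I C D).
Proof.
move=> a h h'; rewrite /cartan_UEA -env_inj_linear; congr env_inj.
have /cc_ax/pclsP := lie_rel (serre_linear a h h').
by rewrite !pclsE.
Qed.

Lemma cartan_UEA_comm (h h' : cartan_sub D) :
  GRing.comm (cartan_UEA h) (cartan_UEA h').
Proof.
apply/eqP; rewrite -subr_eq0 /cartan_UEA -env_inj_bracket.
have -> : bracket (lie_gen (@serre_rel I C D) (gen_h h))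
                  (lie_gen (@serre_rel I C D) (gen_h h')) = 0.
  have /cc_ax/pclsP := lie_rel (serre_hh h h').
  by rewrite !pclsE.
have := @env_inj_linear (root_lie D) (-1) 0 0.
by rewrite scaler0 addr0 scaleN1r addNr => ->.
Qed.

Definition coweight y : U := cartan_UEA (one_tensor y).

Lemma coweightD : {morph coweight : y z / y + z}.
Proof.
move=> y z; rewrite /coweight one_tensorD -[one_tensor y]scale1r.
by rewrite cartan_UEA_linear !scale1r.
Qed.

Lemma rpairMn y l n : << y *+ n, l >> = << y, l >> *+ n.
Proof.
have b0 : << 0 : Y, l >> = 0.
  by apply: (addrI << 0 : Y, l >>); rewrite -rpairDl !addr0.
by elim: n => [|n IHn]; rewrite ?mulr0n // !mulrS rpairDl IHn.
Qed.

Lemma rpairB y l m : << y, l - m >> = << y, l >> - << y, m >>.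
Proof. by apply: (addIr << y, m >>); rewrite -rpairDr !subrK. Qed.

Lemma rpair_nondeg l : l != 0 -> exists y, << y, l >> != 0.
Proof.
move=> l0; apply/not_existsP => yl0.
pose f (y : Y) : int := 0.
have f_add : zmod_morphism f by move=> y z; rewrite subr0.
pose f' := GRing.isZmodMorphism.Build _ _ f f_add.
pose g : {additive Y -> int} := HB.pack f f'.
have [x [_ x_uniq]] := rpair_perfectr g.
have x0 : x = 0.
  apply: x_uniq => y; apply: (addrI << y, 0 : X >>).
  by rewrite -rpairDr !addr0.
move/eqP: l0; apply; rewrite -x0; apply/esym/x_uniq => y.
by apply/eqP/negPn/negP => /yl0.
Qed.

(** Distinct weights have a non-zero difference, on which some [y] is non-zero
    because the pairing is perfect; a generic [y] serves for all pairs. *)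
Lemma exists_separating (s : seq X) :
  exists y, {in s &, injective (fun l => << y, l >>%:Q)}.
Proof.
have [y yP] := exists_nonvanishing (@rpairDl _ _ D) rpair_nondeg
  [seq l - m | l <- s, m <- s].
exists y => l m ls ms /eqP; rewrite eqr_int -subr_eq0 -rpairB => lm.
apply/eqP; rewrite -subr_eq0; apply/negPn/negP => lm0.
by have := yP _ (allpairs_f _ ls ms) lm0; rewrite lm.
Qed.

(** Weights are tested on [Y] only, which spans [Q (x) Y]. *)
Lemma weight_spaceP (V : lmodType U) l (v : V) :
  weight_space l v <-> forall y, coweight y *: v = (<< y, l >>%:Q)%:A *: v.
Proof.
split=> [vl y|vl h]; first by rewrite vl hpair_one_tensor.
elim/rat_tensor_ind: h => [|a h h' hv h'v|y]; last first.
- by rewrite -/(coweight y) vl hpair_one_tensor.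
- rewrite cartan_UEA_linear hpair_linear !scalerDl h'v; congr (_ + _).
  by rewrite -[cartan_UEA h]mul1r scalerAl -scalerA hv scalerA -scalerAl mul1r
    scalerA.
have := cartan_UEA_linear (-1) 0 0.
have := hpair_linear l (-1) 0 0.
by rewrite !scaleN1r !addNr => -> ->; rewrite !scale0r.
Qed.

Definition weight_poly (P : seq X) y : {poly rat} :=
  \prod_(l <- P) ('X - (<< y, l >>%:Q)%:P).

Lemma schur_relE (pi : set X) y :
  schur_rel pi y =
  horner_alg (coweight y) (weight_poly (fset_set (weyl_orbits pi)) y).
Proof.
rewrite /weight_poly rmorph_prod; apply: eq_bigr => l _.
by rewrite rmorphB /= horner_algX horner_algC -(rmorph_int (in_alg U)).
Qed.

Section Module.
Variable V : lmodType U.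
Implicit Types v w : V.

Lemma weight_horner l v p y : weight_space l v ->
  horner_alg (coweight y) p *: v = p.[<< y, l >>%:Q]%:A *: v.
Proof. by move/weight_spaceP => vl; exact: horner_alg_eigen. Qed.

(** For [y] separating the weights in [s], the Lagrange polynomial of [l] in
    the element [y] maps the sum to [c l]. *)
Lemma weight_indep (s : seq X) (c : X -> V) : uniq s ->
  (forall l, l \in s -> weight_space l (c l)) ->
  \sum_(l <- s) c l = 0 -> forall l, l \in s -> c l = 0.
Proof.
move=> s_uniq cP sum0 l ls; have [y y_inj] := exists_separating s.
have := congr1 (GRing.scale (horner_alg (coweight y)
  (lagrange (fun l => << y, l >>%:Q) s l))) sum0.
rewrite scaler0 scaler_sumr (bigD1_seq l) //= big1_seq; last first.
  move=> m /andP[ml ms]; rewrite (weight_horner _ _ (cP m ms)) lagrangeE //.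
  by rewrite eq_sym (negPf ml) !scale0r.
by rewrite addr0 (weight_horner _ _ (cP l ls)) lagrangeE // eqxx !scale1r.
Qed.

Lemma weight_sum_uniq (c c' : {fsfun X -> V with 0}) :
  (forall l, weight_space l (c l)) -> (forall l, weight_space l (c' l)) ->
  \sum_(l <- finsupp c) c l = \sum_(l <- finsupp c') c' l -> c = c'.
Proof.
move=> cP c'P cc'; pose S := (finsupp c `|` finsupp c')%fset.
have sumS (d : {fsfun X -> V with 0}) : (finsupp d `<=` S)%fset ->
    \sum_(l <- finsupp d) d l = \sum_(l <- S) d l.
  by move=> dS; apply: big_fset_incl => // l _ /fsfun_dflt.
have zero l : l \in S -> c l - c' l = 0.
  move=> lS; apply: (@weight_indep S (fun l => c l - c' l)) lS.
  - exact: fset_uniq.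
  - by move=> m _ h; rewrite scalerBr cP c'P -scalerBr.
  - by rewrite sumrB -!sumS ?fsubsetUl ?fsubsetUr // cc' subrr.
apply/fsfunP => l; have [lS|] := boolP (l \in S).
  by apply/eqP; rewrite -subr_eq0 zero.
by rewrite inE => /norP[lc lc']; rewrite !fsfun_dflt.
Qed.

Variable P : {fset X}.
Hypothesis P_kills : forall y v,
  horner_alg (coweight y) (weight_poly P y) *: v = 0.

(** Compare the relations of [y] and of [N y0 + y] on [w], both read as
    polynomials in [y].  The second one is [(X - <y, l>) q] with [q] prime to
    the first for large [N], so that [(y - <y, l>) w] is killed by two coprime
    polynomials in [y]. *)
Lemma eigen_weight y0 l w : {in P &, injective (fun l => << y0, l >>%:Q)} ->
  l \in P -> coweight y0 *: w = (<< y0, l >>%:Q)%:A *: w -> weight_space l w.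
Proof.
move=> y0_inj lP y0w; apply/weight_spaceP => y.
(* The [N] excluded are those for which [<y, k>] is a root of [q]: this means
   [<y, k> - <y, m> + <y0, l - m> N = 0] for some [m] other than [l]. *)
have [N NP] := exists_avoid
  [seq (<< y, k >> - << y, m >>, << y0, l - m >>) | k <- P, m <- P].
pose b := << y0, l >>%:Q *+ N.
have y0Nw : coweight (y0 *+ N) *: w = b%:A *: w.
  rewrite /b; elim: (N) => [|n IHn].
    have -> : coweight (y0 *+ 0) = 0.
      by apply: (addrI (coweight (y0 *+ 0))); rewrite -coweightD !addr0.
    by rewrite !scale0r.
  by rewrite !mulrS coweightD !scalerDl IHn y0w.
pose q := \prod_(m <- rem l P) ('X - (<< y0 *+ N + y, m >>%:Q - b)%:P).
pose w1 := horner_alg (coweight y) ('X - (<< y, l >>%:Q)%:P) *: w.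
have w1_0 : w1 = 0.
  apply: (@coprimep_horner_alg_eq0 _ _ V (coweight y) (weight_poly P y) q)
    => //.
    apply: coprimep_prod_XsubC => m.
    rewrite (mem_rem_uniq _ (fset_uniq P)) => /andP[/= ml mP].
    rewrite /root horner_prod prodf_seq_neq0; apply/allP => k kP /=.
    rewrite hornerXsubC rpairDl rpairMn intrD rmorphMn /=.
    have y0lm : << y0, l - m >> != 0.
      rewrite rpairB subr_eq0; apply: contra_neq ml => lm.
      by apply: y0_inj => //; rewrite lm.
    have := NP _ (allpairs_f
      (fun k m => (<< y, k >> - << y, m >>, << y0, l - m >>)) kP mP) y0lm.
    rewrite /= -(intr_eq0 rat) intrD rmorphMn /= rpairB !intrB -oppr_eq0.
    by congr (_ != 0); rewrite /b mulrnBl; ring.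
  have := P_kills (y0 *+ N + y) w.
  rewrite coweightD (horner_alg_shift _ _ y0Nw); last exact: cartan_UEA_comm.
  rewrite /w1 scalerA -rmorphM => <-; congr (horner_alg _ _ *: _).
  rewrite /weight_poly (big_rem l) //= rmorphM /= rmorph_prod mulrC.
  have shiftE x : ('X - x%:P) \Po ('X + b%:P) = 'X - (x - b)%:P.
    by rewrite comp_polyB comp_polyX comp_polyC polyCB; ring.
  rewrite shiftE rpairDl rpairMn intrD rmorphMn /= addrAC subrr add0r.
  by congr (_ * _); apply: eq_bigr => m _; rewrite /= shiftE.
move/eqP: w1_0; rewrite /w1 rmorphB /= horner_algX horner_algC scalerBl.
by rewrite subr_eq0 => /eqP.
Qed.

(** The components of [v] are its images under the Lagrange polynomials of
    an element [y] that separates [P]. *)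
Lemma exists_weight_sum v : exists c : {fsfun X -> V with 0},
  [/\ forall l, weight_space l (c l), (finsupp c `<=` P)%fset &
      v = \sum_(l <- finsupp c) c l].
Proof.
(* Over no nodes the Lagrange polynomials sum to 0 instead of 1, but then the
   empty product 1 kills [V]. *)
have [P0|P_gt0] := posnP (size P).
  have v0 : v = 0.
    have := P_kills 0 v; rewrite /weight_poly (size0nil P0) big_nil.
    by rewrite rmorph1 scale1r.
  exists [fsfun]; rewrite finsupp0; split=> [l|//|]; last by rewrite big_nil.
  by rewrite fsfunE => h; rewrite !scaler0.
have [y y_inj] := exists_separating P.
pose e l :=
  horner_alg (coweight y) (lagrange (fun l => << y, l >>%:Q) P l) *: v.
have eP l : l \in P -> weight_space l (e l).
  move=> lP; apply: (eigen_weight y_inj lP).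
  have [c cE] := XsubC_lagrange (fun l => << y, l >>%:Q) (fset_uniq P) lP.
  apply/eqP; rewrite -subr_eq0 -scalerBl -(horner_algC (coweight y)).
  rewrite -{1}(horner_algX (coweight y)).
  rewrite -rmorphB /= scalerA -rmorphM /= cE.
  by rewrite -mul_polyC rmorphM /= -scalerA P_kills scaler0.
pose c : {fsfun X -> V with 0} := [fsfun l in P => e l].
have cE l : c l = if l \in P then e l else 0 by rewrite fsfunE.
have cP : (finsupp c `<=` P)%fset.
  apply/fsubsetP => l; rewrite mem_finsupp cE.
  by case: ifP; rewrite ?eqxx.
exists c; split=> [l|//|].
  rewrite cE; case: ifP => [|_ h]; [exact: eP | by rewrite !scaler0].
rewrite (big_fset_incl _ cP) => [|l _ /fsfun_dflt //].
rewrite (eq_big_seq e) => [|l lP]; last by rewrite cE lP.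
rewrite -scaler_suml -rmorph_sum (sum_lagrange (fset_uniq P)) //.
by rewrite rmorph1 scale1r.
Qed.

End Module.
End Weights.

(** * Weyl orbits are finite *)

Section WeylOrbits.
Variables (I : finType) (C : cartanDatum I).

Section Form.
Hypothesis C_pos : finite_type C.

Definition qform (v w : {ffun I -> rat}) : rat :=
  \sum_i \sum_j v i * (cform C i j)%:Q * w j.

Lemma qformC v w : qform v w = qform w v.
Proof.
rewrite /qform exchange_big; apply: eq_bigr => i _; apply: eq_bigr => j _.
by rewrite (cform_sym C j i); ring.
Qed.

Lemma qformDl u v w : qform (u + v) w = qform u w + qform v w.
Proof.
rewrite -big_split; apply: eq_bigr => i _; rewrite -big_split.
by apply: eq_bigr => j _; rewrite ffunE /=; ring.
Qed.

Lemma qformNl v w : qform (- v) w = - qform v w.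
Proof.
apply/eqP; rewrite -addr_eq0 -qformDl addNr /qform big1 // => i _.
by apply: big1 => j _; rewrite ffunE !mul0r.
Qed.

Lemma qform_sqrD v w :
  qform (v + w) (v + w) = qform v v + 2 * qform w v + qform w w.
Proof.
by rewrite !qformDl ![qform _ (v + w)]qformC !qformDl (qformC v w); ring.
Qed.

Lemma qform_sqrB v w :
  qform (v - w) (v - w) = qform v v - 2 * qform w v + qform w w.
Proof. by rewrite qform_sqrD !qformNl (qformC w (- w)) qformNl; ring. Qed.

Lemma qform_ge0 v : 0 <= qform v v.
Proof.
have [->|/C_pos/ltW//] := eqVneq v 0.
by rewrite /qform big1 // => i _; rewrite big1 // => j _; rewrite ffunE !mul0r.
Qed.

(** A positive definite form is non-degenerate: the map from vectors to linear
    forms is injective, hence onto. *)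
Lemma qform_represent (b : {ffun I -> rat}) :
  exists v, forall w, qform v w = \sum_i b i * w i.
Proof.
pose g (v : {ffun I -> rat^o}) : {ffun I -> rat^o} :=
  [ffun i => \sum_j v j * (cform C j i)%:Q].
have g_lin : linear g.
  move=> a u v; apply/ffunP => i; rewrite !ffunE scaler_sumr -big_split.
  by apply: eq_bigr => j _; rewrite !ffunE mulrDl scalerAl.
pose g1 := GRing.isLinear.Build _ _ _ _ g g_lin.
pose g2 : {linear _ -> _} := HB.pack g g1.
have qE v w : qform v w = \sum_i g v i * w i.
  rewrite /qform exchange_big; apply: eq_bigr => j _.
  by rewrite ffunE mulr_suml.
have /lker0_limgf gS : lker (linfun g2) == 0%VS.
  apply/lker0P => u v; rewrite !lfunE /= => guv; apply/eqP; rewrite -subr_eq0.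
  apply: contraT => /C_pos; rewrite -/(qform _ _) qE big1 ?ltxx // => i _.
  have -> : g (u - v) = g u - g v := linearB g2 u v.
  by rewrite guv subrr ffunE mul0r.
have /memv_imgP[v _ bE] : (b : {ffun I -> rat^o}) \in limg (linfun g2).
  by rewrite gS memvf.
by exists v => w; rewrite qE bE lfunE.
Qed.

(** Let [v] represent [b].  The equation [(c, c) = (v, c)] and
    [0 <= (c - v, c - v)] give [(c, c) <= (v, v)].  The coordinate [c i] is
    [(w, c)] for some [w], and [0 <= (c + w, c + w)], [0 <= (c - w, c - w)] give
    [2 |c i| <= (c, c) + (w, w)]. *)
Lemma qform_sphere_bounded (b : {ffun I -> rat}) : exists N : nat,
  forall c, qform c c = \sum_i b i * c i -> forall i, `|c i| <= N%:R.
Proof.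
have [v vP] := qform_represent b.
have [w wP] := choice (fun i : I => qform_represent [ffun j => (j == i)%:R]).
have wE i c : qform (w i) c = c i.
  rewrite wP (bigD1 i) //= ffunE eqxx mul1r big1 ?addr0 // => j ji.
  by rewrite ffunE (negPf ji) mul0r.
pose M := \sum_i qform (w i) (w i) + qform v v.
have M_ge0 : 0 <= M.
  by apply: addr_ge0; [apply: sumr_ge0 => i _|]; exact: qform_ge0.
exists (Num.bound M) => c; rewrite -vP => cc i.
apply: le_trans (ltW (archi_boundP M_ge0)).
have cv : qform c c <= qform v v.
  by have := qform_ge0 (c - v); rewrite qform_sqrB; lra.
have wM : qform (w i) (w i) <= \sum_i qform (w i) (w i).
  by rewrite (bigD1 i) //= lerDl sumr_ge0 // => j _; exact: qform_ge0.
have := qform_ge0 (c - w i); have := qform_ge0 (c + w i).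
by rewrite qform_sqrB qform_sqrD wE /M ler_norml; lra.
Qed.

End Form.

Lemma finite_int_box (N : nat) :
  finite_set [set c : {ffun I -> int} | forall i, (`|c i| <= N)%N].
Proof.
pose f (k : {ffun I -> 'I_(N + N).+1}) : {ffun I -> int} :=
  [ffun i => (k i)%:Z - N%:Z].
apply: (@sub_finite_set _ _ (f @` setT)); last exact/finite_image/finite_finset.
move=> c /= cN; exists [ffun i => inord (absz (c i + N%:Z))] => //.
apply/ffunP => i; have := cN i; rewrite !ffunE => ciN.
rewrite inordK; lia.
Qed.

Variable D : rootDatum C.
Local Notation X := (wlat D).
Local Notation "<< y , l >>" := (rpair y l).

Definition root_sum (c : {ffun I -> int}) : X := \sum_i sroot D i *~ c i.

(** Twice the bilinear pairing [Z[I] x X -> Z] that extends the Cartan form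
    on [Z[I]], with [X] in the second argument through the coroots. *)
Definition root_pair (c : {ffun I -> int}) (l : X) : int :=
  \sum_i c i * cform C i i * << coroot D i, l >>.

Lemma root_pairDr c : {morph root_pair c : l m / l + m}.
Proof.
move=> l m; rewrite -big_split; apply: eq_bigr => i _.
by rewrite rpairDr mulrDr.
Qed.

Lemma root_pairDl c d l : root_pair (c + d) l = root_pair c l + root_pair d l.
Proof.
rewrite -big_split; apply: eq_bigr => i _.
by rewrite ffunE !mulrDl.
Qed.

Lemma root_pairNl c l : root_pair (- c) l = - root_pair c l.
Proof.
by rewrite -sumrN; apply: eq_bigr => i _; rewrite ffunE !mulNr.
Qed.

Lemma root_sumD c d : root_sum (c + d) = root_sum c + root_sum d.
Proof.
by rewrite -big_split; apply: eq_bigr => i _; rewrite ffunE mulrzDr.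
Qed.

Lemma root_sumN c : root_sum (- c) = - root_sum c.
Proof. by rewrite -sumrN; apply: eq_bigr => i _; rewrite ffunE mulrNz. Qed.

Lemma cform_coroot i j :
  cform C i i * << coroot D i, sroot D j >> = 2 * cform C i j.
Proof.
apply: (@intr_inj rat); rewrite !intrM rpair_coroot_root.
have [n ->] := cform_diag C i; field.
by rewrite pnatr_eq0 -muln2 muln_eq0.
Qed.

Lemma rpair0r (y : cwlat D) : << y, 0 >> = 0.
Proof. by apply: (addrI << y, 0 >>); rewrite -rpairDr !addr0. Qed.

Lemma rpairMzr (y : cwlat D) (l : X) (n : int) :
  << y, l *~ n >> = << y, l >> * n.
Proof.
have h : zmod_morphism (rpair y).
  by move=> a b; apply: (addIr << y, b >>); rewrite -rpairDr !subrK.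
pose f : {additive X -> int} :=
  HB.pack (rpair y) (GRing.isZmodMorphism.Build _ _ _ h).
rewrite -mulrzz; exact: (raddfMz f).
Qed.

Lemma root_pair_sum c d :
  root_pair c (root_sum d) = 2 * \sum_i \sum_j c i * cform C i j * d j.
Proof.
rewrite /root_pair mulr_sumr; apply: eq_bigr => i _.
rewrite /root_sum (big_morph (rpair (coroot D i)) (rpairDr _) (rpair0r _)).
rewrite !mulr_sumr; apply: eq_bigr => j _.
by rewrite rpairMzr mulrA -(mulrA (c i)) cform_coroot; ring.
Qed.

Lemma root_pair_sumC c d : root_pair c (root_sum d) = root_pair d (root_sum c).
Proof.
rewrite !root_pair_sum exchange_big; congr (2 * _); apply: eq_bigr => j _.
by apply: eq_bigr => i _; rewrite (cform_sym C i j); ring.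
Qed.

(** If the Cartan form extended to [X] invariantly, the condition
    [root_pair c (l + m) = 0] with [c = l - m] would read
    [2 (l - m, l + m) = 0], that is [(l, l) = (m, m)].  Written with [c], it
    makes sense for any root datum. *)
Definition equal_length (l m : X) : Prop :=
  exists c, l - m = root_sum c /\ root_pair c (l + m) = 0.

Lemma equal_length_sym l m : equal_length l m -> equal_length m l.
Proof.
move=> [c [lm cp]]; exists (- c).
by rewrite root_sumN -lm opprB root_pairNl (addrC m l) cp oppr0.
Qed.

(** Up to the symmetry of the Cartan form, the condition for [l] and [n] is
    the sum of those for [l], [m] and for [m], [n]. *)
Lemma equal_length_trans m l n :
  equal_length l m -> equal_length m n -> equal_length l n.
Proof.
move=> [c [lm cp]] [d [mn dp]]; exists (c + d); split.
  by rewrite root_sumD -lm -mn addrA subrK.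
have := root_pair_sumC c d; rewrite -lm -mn.
have rN e x : root_pair e (- x) = - root_pair e x.
  have r0 : root_pair e 0 = 0.
    by apply: (addrI (root_pair e 0)); rewrite -root_pairDr !addr0.
  by apply/eqP; rewrite -addr_eq0 -root_pairDr addNr r0.
by move: cp dp; rewrite !root_pairDl !root_pairDr !rN; lia.
Qed.

Lemma equal_length_refl l : equal_length l l.
Proof.
exists 0; rewrite subrr /root_sum /root_pair; split.
  by rewrite big1 // => i _; rewrite ffunE mulr0z.
by rewrite big1 // => i _; rewrite ffunE !mul0r.
Qed.

Lemma equal_length_simple_refl i l : equal_length l (simple_refl i l).
Proof.
set n := << coroot D i, l >>.
exists [ffun j => if j == i then n else 0]; split.
  rewrite /simple_refl subKr /root_sum (bigD1 i) //= ffunE eqxx.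
  by rewrite big1 ?addr0 // => j ji; rewrite ffunE (negPf ji).
rewrite /root_pair (bigD1 i) //= big1 ?addr0; last first.
  by move=> j ji; rewrite ffunE (negPf ji) !mul0r.
rewrite ffunE eqxx -mulrA [_ * << _, _ >>](_ : _ = 0) ?mulr0 //.
rewrite rpairDr /simple_refl -mulNrz rpairDr.
have -> : - sroot D i *~ << coroot D i, l >> = sroot D i *~ (- n).
  by rewrite mulrNz mulNrz.
rewrite rpairMzr -/n mulrDr mulrDr mulrA cform_coroot; lia.
Qed.

Lemma equal_length_weyl w : weyl_group w -> forall l : X, equal_length l (w l).
Proof.
elim=> {w} [i|//|w w' _ IHw _ IHw' l|w w' _ IHw _ wK l].
- exact: equal_length_simple_refl.
- exact: equal_length_refl.
- exact: equal_length_trans (IHw' l) (IHw _).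
- by apply: equal_length_sym; have := IHw (w' l); rewrite wK.
Qed.

(** Substituting [m = l - c] in [root_pair c (l + m) = 0] gives
    [root_pair c l = (c, c)], the equation of an ellipsoid. *)
Lemma finite_equal_length : finite_type C ->
  forall l, finite_set [set m | equal_length l m].
Proof.
move=> C_pos l.
have [N NP] := qform_sphere_bounded C_pos
  [ffun i => (cform C i i * << coroot D i, l >>)%:~R].
apply: (sub_finite_set _
  (finite_image (fun c => l - root_sum c) (finite_int_box N))).
move=> m /= [c [lm cp]]; exists c; last by rewrite -lm subKr.
move=> i; have := NP [ffun i => (c i)%:~R] _ i.
rewrite ffunE -intr_norm pmulrn ler_int -abszE lez_nat; apply.
have llE : l + m + root_sum c = l + l by rewrite -lm addrACA subrr addr0.
have : root_pair c l = \sum_i \sum_j c i * cform C i j * c j.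
  have := congr1 (root_pair c) llE.
  by rewrite !root_pairDr root_pair_sum -root_pairDr cp; lia.
move/(congr1 (intr : int -> rat)); rewrite /root_pair !rmorph_sum => e.
rewrite /qform.
transitivity (\sum_i ((\sum_j c i * cform C i j * c j)%:~R : rat)).
  apply: eq_bigr => k _; rewrite rmorph_sum; apply: eq_bigr => j _.
  by rewrite !ffunE !rmorphM.
rewrite -e; apply: eq_bigr => k _; rewrite !ffunE -intrM; congr _%:~R; ring.
Qed.

Lemma weyl_orbits_finite (pi : set X) :
  finite_type C -> finite_set pi -> finite_set (weyl_orbits pi).
Proof.
move=> C_pos pi_fin.
apply: (@sub_finite_set _ _ (\bigcup_(l in pi) [set m | equal_length l m])).
  by move=> _ [w [l [wW pil ->]]]; exists l => //; exact: equal_length_weyl.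
by apply: bigcup_finite => // l _; exact: finite_equal_length.
Qed.

End WeylOrbits.

(** * The defining ideal *)

Section DefiningIdeal.
Variables (I : finType) (C : cartanDatum I) (D : rootDatum C).
Variable pi : set (wlat D).

Lemma defining_ideal_two_sided : two_sided_ideal (defining_ideal pi).
Proof.
split=> [|u v uP vP|a u uP|a u uP] V VC x.
- by rewrite scale0r.
- by rewrite scalerDl uP // vP // addr0.
- by rewrite -scalerA uP // scaler0.
- by rewrite -scalerA uP.
Qed.

Lemma ideal_generated_two_sided (A : pzRingType) (S : set A) :
  two_sided_ideal (ideal_generated S).
Proof.
split=> [|u v uS vS|a u uS|a u uS] J [J_ideal SJ];
  have [J0 JD JMl JMr] := J_ideal.
- exact: J0.
- by apply: JD; [apply: uS|apply: vS].
- by apply: JMl; apply: uS.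
- by apply: JMr; apply: uS.
Qed.

Hypothesis orbits_fin : finite_set (weyl_orbits pi).

Lemma defining_ideal_schur_rel y : defining_ideal pi (schur_rel pi y).
Proof.
move=> V [_ V_sum] x; have [c [[cP c_supp ->] _]] := V_sum x.
rewrite scaler_sumr big1_seq // => l /andP[_ /c_supp lP].
rewrite schur_relE (weight_horner _ _ (cP l)) -[RHS](scale0r (c l)).
congr (_ *: _); rewrite -[RHS](scale0r 1); congr (_ *: _).
rewrite /weight_poly horner_prod (big_rem l) /=.
  by rewrite hornerXsubC subrr mul0r.
by rewrite in_fset_set // inE.
Qed.

(** The decomposition into weights in [P] serves as well for the one into
    arbitrary weights, since uniqueness holds without restriction on the
    weights. *)
Lemma in_C_pi_killed (V : lmodType (UEA D)) :
  (forall y (x : V), schur_rel pi y *: x = 0) -> in_C_pi pi V.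
Proof.
move=> V0; have killed y (x : V) : horner_alg (coweight y)
    (weight_poly (fset_set (weyl_orbits pi)) y) *: x = 0.
  by rewrite -schur_relE.
suff VP (Q : set (wlat D)) : weyl_orbits pi `<=` Q -> weight_sum Q V.
  by split; exact: VP.
move=> sQ x; have [c [cP c_supp xE]] := exists_weight_sum killed x.
exists c; split=> [|c' [c'P _ xE']].
  split=> // l /(fsubsetP c_supp); rewrite in_fset_set // inE => lP.
  exact: sQ.
by apply: weight_sum_uniq; rewrite // -xE.
Qed.

End DefiningIdeal.

Theorem corollary5p4 (I : finType) (C : cartanDatum I) (D : rootDatum C)
    (finC : finite_type C)
    (pi : set (wlat D))
    (pi_dom : pi `<=` @dominant I C D)
    (pi_fin : finite_set pi) (pi_sat : saturated pi) :
  defining_ideal pi = ideal_generated (range (schur_rel pi)).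
Proof.
have orbits_fin := weyl_orbits_finite finC pi_fin.
apply/seteqP; split=> [u u_kills|]; last first.
  apply: smallest_sub; first exact: defining_ideal_two_sided.
  by move=> u [y _ <-]; exact: defining_ideal_schur_rel.
have J_ideal := ideal_generated_two_sided (range (schur_rel pi)).
have quot_C : in_C_pi pi (ideal_quotient J_ideal).
  apply: in_C_pi_killed => // y x; have [v ->] := ideal_class_surj x.
  rewrite ideal_classZ; apply/ideal_class_eq0.
  have [_ _ _ JMr] := J_ideal; apply: JMr.
  by apply: sub_gen_smallest; exists y.
have := u_kills _ quot_C (ideal_class J_ideal 1).
by rewrite ideal_classZ mulr1 => /ideal_class_eq0.
Qed.
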